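(* Consider a reversible resource theory with set of free operations $\mathbb{F}$ and unique asymptotic resource measure $M=M^\infty$, and suppose that it admits one-shot free convertibility: for any two states $\rho,\sigma$ with $M(\rho)\ge M(\sigma)$ there exists a free operation $\mathcal{F}\in\mathbb{F}$ with $\sigma=\mathcal{F}(\rho)$. Then the operation Mpemba effect and the state-based Mpemba effect are exactly equivalent: for every free (relaxation) operation $\mathcal{N}_t\in\mathbb{F}$, the following two conditions are equivalent. (i) (Operation Mpemba effect) There exists a resource-Markovian dynamics $(\mathcal{E}_\lambda)_{\lambda\in\Lambda}$ such that the induced dynamics $(\mathcal{N}_t\circ\mathcal{E}_\lambda)_{\lambda\in\Lambda}$ is not resource-Markovian in $\lambda$. (ii) (State-based Mpemba effect) There exists a resource-monotonic family of states $(\rho_\lambda)_{\lambda\in\Lambda}$ and parameters $\lambda_1<\lambda_2$ in $\Lambda$ such that $M(\mathcal{N}_t(\rho_{\lambda_1}))<M(\mathcal{N}_t(\rho_{\lambda_2}))$.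
   Context: States are density operators on a Hilbert space. A resource theory consists of a set $\mathbb{F}$ of quantum operations (the free operations), containing the identity and closed under composition, together with a real-valued resource measure $M$ on states that is monotone under free operations: $M(\mathcal{F}(\rho))\le M(\rho)$ for every state $\rho$ and $\mathcal{F}\in\mathbb{F}$. The resource theory is reversible if there is a unique asymptotic resource measure $M^\infty$ governing optimal asymptotic conversion rates: for any two states $\rho,\sigma$ (with $M^\infty(\sigma)\neq 0$) there exist free operations $\mathcal{F}_n$ (from $n$ copies to $m_n$ copies of the system) and integers $m_n$ with $\lim_{n\to\infty}\|\mathcal{F}_n(\rho^{\otimes n})-\sigma^{\otimes m_n}\|_1=0$ and $\lim_{n\to\infty} m_n/n=M^\infty(\rho)/M^\infty(\sigma)$. In such a theory the resource measure used to define the notions below is $M=M^\infty$. A dynamics is a family $(\mathcal{E}_\lambda)_{\lambda\in\Lambda}$ of free operations (on a single copy of the system) indexed by a real parameter $\lambda\in\Lambda\subset\mathbb{R}$ (continuous or discrete). It is called resource-Markovian if for all $\lambda_1<\lambda_2$ in $\Lambda$ and every state $\rho$, $M(\mathcal{E}_{\lambda_1}(\rho))\ge M(\mathcal{E}_{\lambda_2}(\rho))$. A family of states $(\rho_\lambda)_{\lambda\in\Lambda}$ is resource-monotonic if $M(\rho_{\lambda_1})\ge M(\rho_{\lambda_2})$ whenever $\lambda_1<\lambda_2$ in $\Lambda$. *)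

(* Defs.v *)
From HB Require Import structures.
From mathcomp Require Import all_boot all_order all_algebra.
From mathcomp Require Import sesquilinear complex.
From mathcomp Require Import all_classical all_reals all_analysis.

Set Implicit Arguments.
Unset Strict Implicit.
Unset Printing Implicit Defensive.

Import Order.TTheory GRing.Theory Num.Theory.
Import numFieldNormedType.Exports.

Local Open Scope classical_set_scope.
Local Open Scope ring_scope.
Local Open Scope complex_scope.

(* A complex Hilbert space of arbitrary dimension.  As in [sesquilinear], the
   inner product is linear in its first argument.  The squared norm lives in
   [R[i]], like every norm of a normed module over [R[i]]. *)
Record hilbert (R : realType) := Hilbert {
  hilbert_sort :> completeNormedModType R[i] ;
  hdot : {dot hilbert_sort for Num.conj} ;
  hilbert_norm : forall x : hilbert_sort, `|x| ^+ 2 = hdot x x }.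

Arguments hdot {R h}.

Section Operators.
Variables (R : realType) (H : hilbert R).

Definition lin_span (A : set H) : set H :=
  [set x | exists n (c : 'I_n -> R[i]) (a : 'I_n -> H),
     (forall i, A (a i)) /\ x = \sum_(i < n) c i *: a i].

Definition orthonormal_basis (B : set H) : Prop :=
  (forall e f, B e -> B f -> hdot e f = (e == f)%:R) /\ dense (lin_span B).

Definition onb : set H := xget set0 [set B | orthonormal_basis B].

Definition bounded_op (T : H -> H) : Prop := linear T /\ continuous T.

(* On [R[i]], [0 <= z] means that [z] is real and nonnegative. *)
Definition positive_op (T : H -> H) : Prop := forall x, 0 <= hdot (T x) x.

(* The absolute value |T| of a bounded T: the unique positive square root of
   T^* T, i.e. the positive A with <A x, A y> = <A^2 x, y> = <T^* T x, y>. *)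
Definition abs_op (T : H -> H) : H -> H :=
  xget (fun=> 0) [set A | [/\ bounded_op A, positive_op A &
                             forall x y, hdot (A x) (A y) = hdot (T x) (T y)]].

Definition trace_norm (T : H -> H) : \bar R :=
  \esum_(e in onb) (complex.Re (hdot (abs_op T e) e))%:E.

(* Sum of an absolutely summable family of reals ([esum] is only meaningful for
   nonnegative families). *)
Definition rsum (D : set H) (f : H -> R) : R :=
  fine (\esum_(e in D) (Num.max (f e) 0)%:E)
    - fine (\esum_(e in D) (Num.max (- f e) 0)%:E).

Definition trace (T : H -> H) : R[i] :=
  rsum onb (fun e => complex.Re (hdot (T e) e))
    +i* rsum onb (fun e => complex.Im (hdot (T e) e)).

Record traceClass := TraceClass {
  tc_op :> H -> H ;
  tc_bounded : bounded_op tc_op ;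
  tc_norm : (trace_norm tc_op < +oo)%E }.

Record state := State {
  state_op :> traceClass ;
  state_pos : positive_op state_op ;
  state_trace : trace state_op = 1 }.

(* The matrix of operators (T i j) is positive as an operator on H^n, the
   Hilbert space C^n (x) H. *)
Definition positive_opmx (n : nat) (T : 'I_n -> 'I_n -> traceClass) : Prop :=
  forall x : 'I_n -> H, 0 <= \sum_(i < n) \sum_(j < n) hdot (T i j (x j)) (x i).

End Operators.

(* Quantum operations: completely positive trace-preserving linear maps between
   trace-class operators.  [traceClass] carries no vector-space structure, so
   linearity is stated on the underlying operators. *)
Record channel (R : realType) (H K : hilbert R) := Channel {
  channel_fun :> traceClass H -> traceClass K ;
  channel_linear : forall (a : R[i]) (S T U : traceClass H),
    (forall x, U x = a *: S x + T x) ->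
    forall y, channel_fun U y = a *: channel_fun S y + channel_fun T y ;
  channel_cp : forall (n : nat) (T : 'I_n -> 'I_n -> traceClass H),
    positive_opmx T -> positive_opmx (fun i j => channel_fun (T i j)) ;
  channel_tp : forall T : traceClass H, trace (channel_fun T) = trace T }.

Section Channels.
Variable R : realType.

Lemma channel_pos (H K : hilbert R) (E : channel H K) (T : traceClass H) :
  positive_op T -> positive_op (E T).
Proof.
move=> Tpos x.
have /(@channel_cp _ _ _ E)/(_ (fun=> x)) : positive_opmx (fun _ _ : 'I_1 => T).
  by move=> y; rewrite !big_ord1.
by rewrite !big_ord1.
Qed.

Definition apply_channel (H K : hilbert R) (E : channel H K) (rho : state H) :
    state K :=
  State (channel_pos E (state_pos rho))
        (etrans (channel_tp E rho) (state_trace rho)).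

Definition channel_id (H : hilbert R) : channel H H.
Proof. by exists (fun T => T). Defined.

Definition channel_comp (H K L : hilbert R) (F : channel K L) (E : channel H K) :
  channel H L.
Proof.
exists (fun T => F (E T)).
- by move=> a S T U /(@channel_linear _ _ _ E)/(@channel_linear _ _ _ F).
- by move=> n T /(@channel_cp _ _ _ E)/(@channel_cp _ _ _ F).
- by move=> T; rewrite !channel_tp.
Defined.

End Channels.

(* The system together with its tensor powers: [copies n] is the Hilbert space
   of n copies, the system itself being [copies 1], and [tens x] is the
   elementary tensor x_0 (x) ... (x) x_(n-1).  The axioms determine [copies n]
   up to a unique unitary; multilinearity of [tens] follows from [tens_dot]. *)
Record system (R : realType) := System {
  copies :> nat -> hilbert R ;
  tens : forall n, ('I_n -> copies 1) -> copies n ;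
  tens1 : forall x : 'I_1 -> copies 1, tens x = x ord0 ;
  tens_dot : forall n (x y : 'I_n -> copies 1),
    hdot (tens x) (tens y) = \prod_(i < n) hdot (x i) (y i) ;
  tens_dense : forall n, dense (lin_span (range (@tens n))) }.

(* [tau] is the n-fold tensor power of [rho]: the operator that acts as
   tau (x_0 (x) ... (x) x_(n-1)) = rho x_0 (x) ... (x) rho x_(n-1). *)
Definition is_tensor_power (R : realType) (S : system R) (n : nat)
    (rho : state (S 1)) (tau : state (S n)) : Prop :=
  forall x : 'I_n -> S 1, tau (tens x) = tens (fun i => rho (x i)).

Definition resource_monotone (R : realType) (S : system R)
    (free_op : forall n m, set (channel (S n) (S m)))
    (M : forall n, state (S n) -> R) : Prop :=
  forall n m (F : channel (S n) (S m)) (rho : state (S n)),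
    free_op n m F -> M m (apply_channel F rho) <= M n rho.

Record resource_theory (R : realType) (S : system R) := ResourceTheory {
  free_op : forall n m, set (channel (S n) (S m)) ;
  resource_measure : forall n, state (S n) -> R ;
  free_id : forall n, free_op (channel_id (S n)) ;
  free_comp : forall n m p (F : channel (S m) (S p)) (E : channel (S n) (S m)),
    free_op F -> free_op E -> free_op (channel_comp F E) ;
  resource_measure_monotone : resource_monotone free_op resource_measure }.

Section Theory.
Variables (R : realType) (S : system R) (T : resource_theory S).

(* Rate [r] is achievable for the asymptotic conversion of [rho] into [sigma];
   [rhon n] and [sigman n] are the n-th and the (m n)-th tensor power. *)
Definition achievable_rate (rho sigma : state (S 1)) (r : R) : Prop :=
  exists (m : nat -> nat) (F : forall n, channel (S n) (S (m n)))
         (rhon : forall n, state (S n)) (sigman : forall n, state (S (m n))),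
    [/\ forall n, free_op T (F n),
        forall n, is_tensor_power rho (rhon n),
        forall n, is_tensor_power sigma (sigman n),
        trace_norm (fun x => apply_channel (F n) (rhon n) x - sigman n x)
          @[n --> \oo] --> 0%E &
        (m n)%:R / n%:R @[n --> \oo] --> r].

Definition governs_rates (M : forall n, state (S n) -> R) : Prop :=
  forall rho sigma : state (S 1), M 1%N sigma != 0 ->
    achievable_rate rho sigma (M 1%N rho / M 1%N sigma) /\
    (forall r, achievable_rate rho sigma r -> r <= M 1%N rho / M 1%N sigma).

(* The measure of the theory is the asymptotic measure M^oo.  Rates only involve
   ratios, so it can be unique only up to normalization. *)
Definition reversible : Prop :=
  governs_rates (resource_measure T) /\
  forall M : forall n, state (S n) -> R,
    resource_monotone (free_op T) M -> governs_rates M ->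
    exists c : R,
      forall rho : state (S 1), M 1%N rho = c * resource_measure T rho.

Definition one_shot_convertible : Prop :=
  forall rho sigma : state (S 1),
    resource_measure T sigma <= resource_measure T rho ->
    exists2 F : channel (S 1) (S 1), free_op T F & sigma = apply_channel F rho.

(* Families indexed by [Lambda] are functions on [R] whose values outside
   [Lambda] are irrelevant. *)
Definition dynamics (Lambda : set R) (E : R -> channel (S 1) (S 1)) : Prop :=
  forall l, Lambda l -> free_op T (E l).

Definition resource_Markovian (Lambda : set R)
    (E : R -> channel (S 1) (S 1)) : Prop :=
  forall l1 l2, Lambda l1 -> Lambda l2 -> l1 < l2 -> forall rho : state (S 1),
    resource_measure T (apply_channel (E l2) rho)
      <= resource_measure T (apply_channel (E l1) rho).

Definition resource_monotonic (Lambda : set R) (rho : R -> state (S 1)) : Prop :=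
  forall l1 l2, Lambda l1 -> Lambda l2 -> l1 < l2 ->
    resource_measure T (rho l2) <= resource_measure T (rho l1).

Definition operation_Mpemba (Lambda : set R) (N : channel (S 1) (S 1)) : Prop :=
  exists E : R -> channel (S 1) (S 1),
    [/\ dynamics Lambda E, resource_Markovian Lambda E &
        ~ resource_Markovian Lambda (fun l => channel_comp N (E l))].

Definition state_Mpemba (Lambda : set R) (N : channel (S 1) (S 1)) : Prop :=
  exists rho : R -> state (S 1),
    resource_monotonic Lambda rho /\
    exists l1 l2, [/\ Lambda l1, Lambda l2, l1 < l2 &
      resource_measure T (apply_channel N (rho l1))
        < resource_measure T (apply_channel N (rho l2))].

End Theory.

(* Main.v *)
(* A drop of M along a family of states between l1 < l2 is realized by a single
   free operation F with F(rho l1) = rho l2, and the step dynamics that jumps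
   from the identity to F at l2 is resource-Markovian by monotonicity of M.
   Conversely, a dynamics witnessing the operation effect is evaluated on the
   initial state at which Markovianity of the induced dynamics fails. *)
Require Import Defs.
From mathcomp Require Import all_boot all_order all_algebra.
From mathcomp Require Import all_classical all_reals all_analysis.

Import Order.TTheory.

(** The underlying operators agree by computation; only the proof fields differ. *)
Lemma apply_channel_id (R : realType) (H : hilbert R) (rho : state H) :
  apply_channel (channel_id H) rho = rho.
Proof. by case: rho => A p q; congr State; exact: Prop_irrelevance. Qed.

Lemma apply_channel_comp (R : realType) (H K L : hilbert R)
    (F : channel K L) (E : channel H K) (rho : state H) :
  apply_channel (channel_comp F E) rho = apply_channel F (apply_channel E rho).
Proof. by congr State; exact: Prop_irrelevance. Qed.

Theorem propositionS2 (R : realType) (S : system R) (T : resource_theory S)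
    (Hrev : reversible T) (Hconv : one_shot_convertible T)
    (Lambda : set R) (N : channel (S 1) (S 1)) (HN : free_op T N) :
  operation_Mpemba T Lambda N <-> state_Mpemba T Lambda N.
Proof.
split=> [[E [_ Emarkov NEmarkov]]|[rho [rho_mono [l1 [l2 [L1 L2 l12 Nlt]]]]]].
  (* Any violation at an initial state [rho] would make its orbit under [E] a state-based
     witness. *)
  apply: contrapT => nstate; apply: NEmarkov => l1 l2 L1 L2 l12 rho.
  rewrite !apply_channel_comp leNgt; apply/negP => Nlt; apply: nstate.
  exists (fun l => apply_channel (E l) rho); split; last by exists l1, l2.
  by move=> k1 k2 K1 K2 k12; exact: Emarkov.
have [F freeF rho2E] := Hconv _ _ (rho_mono _ _ L1 L2 l12).
(* The strict test gives [E l2 = F], while [l1 < l2] keeps [E l1] the identity. *)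
pose E l := if (l < l2)%R then channel_id (S 1) else F.
exists E; split.
- by move=> l _; rewrite /E; case: ifP => _ //; exact: free_id.
- move=> k1 k2 _ _ k12 sigma; rewrite /E; case: (ltP k2 l2) => [k2l|lk2].
    by rewrite (lt_trans k12 k2l).
  (* Only a pair straddling [l2] needs monotonicity; beyond [l2] both channels are [F]. *)
  case: ifP => // _; rewrite apply_channel_id.
  exact: resource_measure_monotone.
move=> /(_ _ _ L1 L2 l12 (rho l1)).
rewrite !apply_channel_comp /E l12 ltxx apply_channel_id -rho2E.
by rewrite leNgt Nlt.
Qed.
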